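(* Let $\mathcal{B}=(\mathcal{O},\mathscr{C},\mathfrak{R},I,T)$ be an unambiguous bud generating system, with $\mathscr{C}=\{c_1,\dots,c_k\}$, such that $\mathcal{O}$ is a locally finite operad and $\mathfrak{R}(1)$ finitely factorizes $\mathbf{Bud}_{\mathscr{C}}(\mathcal{O})$. For all $a\in\mathscr{C}$, let $\mathbf{f}_a(\mathsf{y}_{c_1},\dots,\mathsf{y}_{c_k})$ be the series of $\mathbb{K}[[\mathbb{Y}_{\mathscr{C}}]]$ satisfying $$\mathbf{f}_a(\mathsf{y}_{c_1},\dots,\mathsf{y}_{c_k})=\mathsf{y}_a+\mathbf{g}_a\bigl(\mathbf{f}_{c_1}(\mathsf{y}_{c_1},\dots,\mathsf{y}_{c_k}),\dots,\mathbf{f}_{c_k}(\mathsf{y}_{c_1},\dots,\mathsf{y}_{c_k})\bigr).$$ Then, for any color $a\in I$ and any type $\alpha\in\mathcal{T}_{\mathscr{C}}$ such that $\mathscr{C}^\alpha\in T^+$, the coefficients $\langle\mathsf{x}_a\mathbb{Y}_{\mathscr{C}}^\alpha,\mathrm{colt}(\mathrm{synt}(\mathcal{B}))\rangle$ and $\langle\mathbb{Y}_{\mathscr{C}}^\alpha,\mathbf{f}_a\rangle$ are equal.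
   Context: Colored operads. Let $\mathscr{C}=\{c_1,\dots,c_k\}$ be a finite set of colors. A $\mathscr{C}$-colored operad $\mathcal{C}=\bigsqcup_{n\geq1}\mathcal{C}(n)$ is a nonsymmetric colored set-operad: each $x\in\mathcal{C}(n)$ has arity $|x|=n$, an output color $\mathrm{out}(x)\in\mathscr{C}$ and a word of input colors $\mathrm{in}(x)\in\mathscr{C}^n$ with $i$-th letter $\mathrm{in}_i(x)$; $x\circ_i y\in\mathcal{C}(|x|+|y|-1)$ is defined iff $\mathrm{out}(y)=\mathrm{in}_i(x)$; there are units $\mathbf{1}_a\in\mathcal{C}(1)$, $a\in\mathscr{C}$, with output and input color $a$; the usual associativity and unit axioms hold. The complete composition is $x\circ[y_1,\dots,y_n]:=(\cdots((x\circ_n y_n)\circ_{n-1}y_{n-1})\cdots)\circ_1 y_1$ (defined when $\mathrm{out}(y_i)=\mathrm{in}_i(x)$ for all $i$). A (monochrome) operad is the case of a single color. $\mathcal{C}$ is locally finite if every $\mathcal{C}(n)$ is finite. Bud operads. For an operad $\mathcal{O}$ with unit $\mathbf{1}$, $\mathbf{Bud}_{\mathscr{C}}(\mathcal{O})$ is the $\mathscr{C}$-colored operad of triples $(a,x,u)\in\mathscr{C}\times\mathcal{O}(n)\times\mathscr{C}^n$, $n\geq1$, with output color $a$, input colors $u$, units $\mathbf{1}_a=(a,\mathbf{1},a)$, and $(a,x,u)\circ_i(b,y,v)=(a,x\circ_i y,u')$ when $b=u_i$, where $u'$ is $u$ with its $i$-th letter replaced by $v$. A bud generating system is a tuple $\mathcal{B}=(\mathcal{O},\mathscr{C},\mathfrak{R},I,T)$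 with $\mathcal{O}$ an operad, $\mathscr{C}$ a finite set of colors, $\mathfrak{R}$ a finite subset of $\mathbf{Bud}_{\mathscr{C}}(\mathcal{O})$ (rules) and $I,T\subseteq\mathscr{C}$ (initial and terminal colors). $T^+$ is the set of nonempty words on $T$. Finite factorization. For a subset $S$ of a $\mathscr{C}$-colored operad $\mathcal{C}$, $S(1)$ is the set of its elements of arity $1$, and $\mathbf{Free}(S)$ is the set of planar rooted trees whose internal nodes with $n\geq1$ children are labeled by arity-$n$ elements of $S$, such that if $v$ is the $i$-th child of $u$ (both internal) then the output color of the label of $v$ is the $i$-th input color of the label of $u$; it contains, for each color $a$, a tree consisting of one leaf with output and input color $a$. The evaluation $\mathrm{ev}_{\mathcal{C}}(\mathfrak{t})\in\mathcal{C}$ is obtained by composing in $\mathcal{C}$ the labels along $\mathfrak{t}$ (the one-leaf tree of color $a$ evaluates to $\mathbf{1}_a$). $S$ finitely factorizes $\mathcal{C}$ if for each $x\in\mathcal{C}$ there are finitely many $\mathfrak{t}\in\mathbf{Free}(S)$ with $\mathrm{ev}_{\mathcal{C}}(\mathfrak{t})=x$. Series. $\mathbb{K}$ is a field of characteristic zero. A $\mathcal{C}$-series is a map $\mathbf{f}:\mathcal{C}\to\mathbb{K}$, with values denoted $\langle x,\mathbf{f}\rangle$. The characteristic series of a subset is its indicator function. $\mathbf{u}$ is the characteristic series of $\{\mathbf{1}_a:a\in\mathscr{C}\}$. Composition product: $\langle x,\mathbf{f}\odot\mathbf{h}\rangle:=\sum_{y,z_1,\dots,z_{|y|}\in\mathcal{C},\,x=y\circ[z_1,\dots,z_{|y|}]}\langle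 y,\mathbf{f}\rangle\prod_{i}\langle z_i,\mathbf{h}\rangle$; on a locally finite colored operad it is associative with unit $\mathbf{u}$. The $\odot$-inverse $\mathbf{f}^{\odot_{-1}}$ of $\mathbf{f}$, when it exists, is the unique series $\mathbf{x}$ with $\mathbf{f}\odot\mathbf{x}=\mathbf{u}=\mathbf{x}\odot\mathbf{f}$. Let $\mathbf{r}$, $\mathbf{i}$, $\mathbf{t}$ be the characteristic series of $\mathfrak{R}$, $\{\mathbf{1}_a:a\in I\}$, $\{\mathbf{1}_a:a\in T\}$ in $\mathbf{Bud}_{\mathscr{C}}(\mathcal{O})$. The syntactic generating series is $\mathrm{synt}(\mathcal{B}):=\mathbf{i}\odot(\mathbf{u}-\mathbf{r})^{\odot_{-1}}\odot\mathbf{t}$ (well-defined when $\mathcal{O}$ is locally finite and $\mathfrak{R}(1)$ finitely factorizes $\mathbf{Bud}_{\mathscr{C}}(\mathcal{O})$). $\mathcal{B}$ is unambiguous if all coefficients of $\mathrm{synt}(\mathcal{B})$ are equal to $0$ or $1$. Types. The type of a nonempty word $u$ on $\mathscr{C}$ is $\mathrm{type}(u)=|u|_{c_1}\dots|u|_{c_k}\in\mathbb{N}^k$, where $|u|_c$ is the number of occurrences of $c$ in $u$. $\mathcal{T}_{\mathscr{C}}$ is the set of all types, i.e. of all nonzero elements of $\mathbb{N}^k$. For a type $\alpha$, $\mathscr{C}^\alpha$ is the word $c_1^{\alpha_1}\dots c_k^{\alpha_k}$. $\mathbb{X}_{\mathscr{C}}=\{\mathsf{x}_{c_1},\dots,\mathsf{x}_{c_k}\}$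 and $\mathbb{Y}_{\mathscr{C}}=\{\mathsf{y}_{c_1},\dots,\mathsf{y}_{c_k}\}$ are sets of commuting variables, $\mathbb{K}[[\mathbb{Y}_{\mathscr{C}}]]$ and $\mathbb{K}[[\mathbb{X}_{\mathscr{C}}\sqcup\mathbb{Y}_{\mathscr{C}}]]$ are the sets of commutative formal power series in these variables, $\mathbb{Y}_{\mathscr{C}}^\alpha=\mathsf{y}_{c_1}^{\alpha_1}\cdots\mathsf{y}_{c_k}^{\alpha_k}$, and $\langle m,\mathbf{s}\rangle$ is the coefficient of the monomial $m$ in $\mathbf{s}$. The series of color types of a $\mathcal{C}$-series $\mathbf{h}$ is $\mathrm{colt}(\mathbf{h})=\sum_{x\in\mathcal{C}}\langle x,\mathbf{h}\rangle\,\mathsf{x}_{\mathrm{out}(x)}\,\mathbb{Y}_{\mathscr{C}}^{\mathrm{type}(\mathrm{in}(x))}\in\mathbb{K}[[\mathbb{X}_{\mathscr{C}}\sqcup\mathbb{Y}_{\mathscr{C}}]]$. For $a\in\mathscr{C}$, $\mathbf{g}_a(\mathsf{y}_{c_1},\dots,\mathsf{y}_{c_k})$ is the polynomial $\mathbf{g}_a:=\sum_{r\in\mathfrak{R},\,\mathrm{out}(r)=a}\mathbb{Y}_{\mathscr{C}}^{\mathrm{type}(\mathrm{in}(r))}$.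
   Formalization: The series f_a are required to have zero constant term; without this the system need not have a unique solution (f = y + f² for one binary rule on one color also has a solution with constant term 1, for which the claim fails). *)

(* Defs.v *)
From HB Require Import structures.
From mathcomp Require Import all_boot all_algebra.
From mathcomp Require Import finmap.
From mathcomp Require Import boolp classical_sets functions cardinality fsbigop.
From mathcomp Require Import zify.

Set Implicit Arguments.
Unset Strict Implicit.
Unset Printing Implicit Defensive.
Import GRing.Theory.

Local Open Scope classical_set_scope.
Local Open Scope ring_scope.

(* The disjoint union of the C(n), n >= 1, is a single carrier (asking for a
   choiceType is no restriction classically); the arity of an element is the
   length of its word of input colors.  Positions are counted from 0.  The partial composition is a total function whose values matter
   only when [out y] is the i-th input color of x, which is what
   [onth (inp x) i = Some (out y)] says (it includes i < arity). *)
Record coloredOperad (C : finType) := ColoredOperad {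
  operad_sort :> choiceType;
  out : operad_sort -> C;
  inp : operad_sort -> seq C;
  ounit : C -> operad_sort;
  ocomp : operad_sort -> nat -> operad_sort -> operad_sort;
  inp_gt0 : forall x, (0 < size (inp x))%N;
  out_ounit : forall a, out (ounit a) = a;
  inp_ounit : forall a, inp (ounit a) = [:: a];
  out_ocomp : forall x i y, onth (inp x) i = Some (out y) ->
    out (ocomp x i y) = out x;
  inp_ocomp : forall x i y, onth (inp x) i = Some (out y) ->
    inp (ocomp x i y) = take i (inp x) ++ inp y ++ drop i.+1 (inp x);
  ocomp1x : forall x, ocomp (ounit (out x)) 0 x = x;
  ocompx1 : forall x i a, onth (inp x) i = Some a -> ocomp x i (ounit a) = x;
  ocompA : forall x i y j z,
    onth (inp x) i = Some (out y) -> onth (inp y) j = Some (out z) ->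
    ocomp (ocomp x i y) (i + j) z = ocomp x i (ocomp y j z);
  ocompAC : forall x i y j z, (i < j)%N ->
    onth (inp x) i = Some (out y) -> onth (inp x) j = Some (out z) ->
    ocomp (ocomp x i y) (j + size (inp y)).-1 z = ocomp (ocomp x j z) i y
}.

Definition operad := coloredOperad unit.

Section ColoredOperadTheory.
Variables (C : finType) (P : coloredOperad C).

Definition arity (x : P) : nat := size (inp x).

Definition locally_finite : Prop :=
  forall n, finite_set [set x : P | arity x = n].

(* x o [y_1, ..., y_n], where the y_i are grafted from the last to the first;
   meaningful when the word of output colors of ys is the word of input colors
   of x. *)
Definition fcomp (x : P) (ys : seq P) : P :=
  foldr (fun iy z => ocomp z iy.1 iy.2) x (zip (iota 0 (size ys)) ys).

(* Leaves carry their color; an internal node carries its label and the list of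
   its children. *)
Inductive tree := Leaf of C | Node of P & seq tree.

Definition tree_out (t : tree) : C :=
  match t with Leaf a => a | Node x _ => out x end.

Fixpoint Free (S : set P) (t : tree) : Prop :=
  match t with
  | Leaf _ => True
  | Node x ts => [/\ S x, map tree_out ts = inp x &
                     foldr and True (map (Free S) ts)]
  end.

Fixpoint ev (t : tree) : P :=
  match t with Leaf a => ounit P a | Node x ts => fcomp x (map ev ts) end.

Definition finitely_factorizes (S : set P) : Prop :=
  forall x : P, finite_set [set t | Free S t /\ ev t = x].

Definition arity_part (S : set P) (n : nat) : set P :=
  [set x | S x /\ arity x = n].

End ColoredOperadTheory.

Section Bud.
Variables (C : finType) (O : operad).

Definition bud := {t : C * O * seq C | size t.2 == arity t.1.2}.

Definition bud_out (X : bud) : C := (\val X).1.1.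
Definition bud_op (X : bud) : O := (\val X).1.2.
Definition bud_in (X : bud) : seq C := (\val X).2.

Lemma size_bud_in (X : bud) : size (bud_in X) = arity (bud_op X).
Proof. exact: eqP (valP X). Qed.

Lemma bud_unit_subproof (a : C) :
  size ([:: a] : seq C) == arity (ounit O tt).
Proof. by rewrite /arity inp_ounit. Qed.

Definition bud_unit (a : C) : bud :=
  exist _ (a, ounit O tt, [:: a]) (bud_unit_subproof a).

(* The triple below satisfies the size constraint whenever i is less than the
   arity of X; the default value X is never used for defined compositions. *)
Definition bud_comp (X : bud) (i : nat) (Y : bud) : bud :=
  insubd X (bud_out X, ocomp (bud_op X) i (bud_op Y),
            take i (bud_in X) ++ bud_in Y ++ drop i.+1 (bud_in X)).

Lemma onth_size (T : Type) (s : seq T) i x : onth s i = Some x -> (i < size s)%N.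
Proof. by move=> h; rewrite -onthTE h. Qed.

Lemma mono_onth (x y : O) i : (i < arity x)%N -> onth (inp x) i = Some (out y).
Proof. by rewrite /arity -onthTE; case: onth => // - []; case: (out y). Qed.

Lemma bud_op_onth (X Y : bud) i :
  onth (bud_in X) i = Some (bud_out Y) ->
  onth (inp (bud_op X)) i = Some (out (bud_op Y)).
Proof. by move=> h; apply: mono_onth; rewrite -size_bud_in (onth_size h). Qed.

Lemma bud_compE X i Y : onth (bud_in X) i = Some (bud_out Y) ->
  \val (bud_comp X i Y) =
    (bud_out X, ocomp (bud_op X) i (bud_op Y),
            take i (bud_in X) ++ bud_in Y ++ drop i.+1 (bud_in X)).
Proof.
move=> h; rewrite /bud_comp val_insubd /= /arity inp_ocomp; last exact: bud_op_onth.
by rewrite !size_cat !size_take !size_drop !size_bud_in eqxx.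
Qed.

Lemma bud_inP (X Y : bud) : bud_out X = bud_out Y -> bud_op X = bud_op Y ->
  bud_in X = bud_in Y -> X = Y.
Proof.
rewrite /bud_out /bud_op /bud_in => h1 h2 h3; apply/val_inj.
by case: (\val X) (\val Y) h1 h2 h3 => [[a x] u] [[b y] v] /= -> -> ->.
Qed.

Lemma bud_out_comp X i Y : onth (bud_in X) i = Some (bud_out Y) ->
  bud_out (bud_comp X i Y) = bud_out X.
Proof. by move=> h; rewrite {1}/bud_out bud_compE. Qed.

Lemma bud_op_comp X i Y : onth (bud_in X) i = Some (bud_out Y) ->
  bud_op (bud_comp X i Y) = ocomp (bud_op X) i (bud_op Y).
Proof. by move=> h; rewrite {1}/bud_op bud_compE. Qed.

Lemma bud_in_comp X i Y : onth (bud_in X) i = Some (bud_out Y) ->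
  bud_in (bud_comp X i Y) =
    take i (bud_in X) ++ bud_in Y ++ drop i.+1 (bud_in X).
Proof. by move=> h; rewrite {1}/bud_in bud_compE. Qed.

Lemma bud_in_gt0 X : (0 < size (bud_in X))%N.
Proof. by rewrite size_bud_in inp_gt0. Qed.

Lemma bud_comp1x X : bud_comp (bud_unit (bud_out X)) 0 X = X.
Proof.
have h : onth (bud_in (bud_unit (bud_out X))) 0 = Some (bud_out X) by [].
apply: bud_inP; rewrite ?bud_out_comp ?bud_op_comp ?bud_in_comp //=.
- by rewrite [bud_op (bud_unit _)]/bud_op /=; case: (out _) (ocomp1x (bud_op X)).
- by rewrite cats0.
Qed.

Lemma bud_compx1 X i a : onth (bud_in X) i = Some a ->
  bud_comp X i (bud_unit a) = X.
Proof.
move=> h; have h' : onth (bud_in X) i = Some (bud_out (bud_unit a)) by [].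
apply: bud_inP; rewrite ?bud_out_comp ?bud_op_comp ?bud_in_comp //=.
- rewrite [bud_op (bud_unit _)]/bud_op /= ocompx1 //.
  by rewrite (mono_onth (ounit O tt)) ?out_ounit // -size_bud_in (onth_size h).
- rewrite -[RHS](cat_take_drop i) [X in _ = _ ++ X](drop_nth a); last first.
    exact: onth_size h.
  by congr (_ ++ _ :: _); apply: esym; apply: onth_nth h.
Qed.

Lemma onth_subst (T : Type) (u v : seq T) i j : (i < size u)%N -> (j < size v)%N ->
  onth (take i u ++ v ++ drop i.+1 u) (i + j) = onth v j.
Proof.
move=> hi hj; rewrite !onth_cat size_take hi addKn hj.
by case: ifP => //; lia.
Qed.

Lemma take_drop_cat (T : Type) n (s t : seq T) : n = size s ->
  (take n (s ++ t) = s) * (drop n (s ++ t) = t).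
Proof. by move=> ->; rewrite take_size_cat ?drop_size_cat. Qed.

Lemma bud_compA X i Y j Z :
  onth (bud_in X) i = Some (bud_out Y) -> onth (bud_in Y) j = Some (bud_out Z) ->
  bud_comp (bud_comp X i Y) (i + j) Z = bud_comp X i (bud_comp Y j Z).
Proof.
move=> hi hj; have si := onth_size hi; have sj := onth_size hj.
have h1 : onth (bud_in (bud_comp X i Y)) (i + j) = Some (bud_out Z).
  by rewrite bud_in_comp // onth_subst.
have h2 : onth (bud_in X) i = Some (bud_out (bud_comp Y j Z)).
  by rewrite bud_out_comp.
apply: bud_inP; rewrite ?bud_out_comp ?bud_op_comp //.
  by rewrite ocompA //; apply: bud_op_onth.
rewrite (bud_in_comp h1) (bud_in_comp h2) (bud_in_comp hi) (bud_in_comp hj).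
move: (bud_in X) (bud_in Y) (bud_in Z) si sj => u v w si sj.
rewrite !take_cat !drop_cat size_takel ?(ltnW si) //.
have -> : (i + j < i)%N = false by lia.
have -> : ((i + j).+1 < i)%N = false by lia.
rewrite addKn -addnS addKn sj -!catA.
congr (_ ++ _ ++ _ ++ _).
case: ltnP => // h; have -> : j.+1 = size v by lia.
by rewrite subnn drop0 drop_size.
Qed.

Lemma cat3E (T : Type) (u : seq T) i j : (i < j)%N -> (j < size u)%N ->
  exists p x q y r, [/\ u = p ++ x :: q ++ y :: r, size p = i &
     (i + (size q).+1)%N = j].
Proof.
move=> ij ju; have h0 : (0 < size u)%N by lia.
case: u h0 ju => // x0 u0 _; set u := x0 :: u0 => ju.
exists (take i u), (nth x0 u i), (take (j - i.+1) (drop i.+1 u)),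
  (nth x0 u j), (drop j.+1 u); split.
- rewrite -[LHS](cat_take_drop i); congr (_ ++ _).
  have iu : (i < size u)%N by lia.
  rewrite (drop_nth x0 iu); congr (_ :: _).
  rewrite -[LHS](cat_take_drop (j - i.+1)) drop_drop; congr (_ ++ _).
  by rewrite subnK // (drop_nth x0 ju).
- by rewrite size_takel //; lia.
- by rewrite size_takel ?size_drop; lia.
Qed.

Lemma bud_compAC X i Y j Z : (i < j)%N ->
  onth (bud_in X) i = Some (bud_out Y) -> onth (bud_in X) j = Some (bud_out Z) ->
  bud_comp (bud_comp X i Y) (j + size (bud_in Y)).-1 Z =
  bud_comp (bud_comp X j Z) i Y.
Proof.
move=> ij hi hj; have si := onth_size hi; have sj := onth_size hj.
have [p [x [q [y [r [uE pE qE]]]]]] := cat3E ij sj.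
have subst_at (p0 : seq C) x0 q0 (v : seq C) n : size p0 = n ->
    take n (p0 ++ x0 :: q0) ++ v ++ drop n.+1 (p0 ++ x0 :: q0) = p0 ++ v ++ q0.
  move=> <-; rewrite take_size_cat // -cat_rcons drop_size_cat //.
  by rewrite size_rcons.
have onth_at (p0 : seq C) x0 q0 n : size p0 = n ->
    onth (p0 ++ x0 :: q0) n = Some x0.
  by move=> <-; rewrite onth_cat ltnn subnn.
have xE : x = bud_out Y.
  by move: hi; rewrite uE onth_at // => -[].
have uE' : bud_in X = (p ++ x :: q) ++ y :: r by rewrite uE -catA.
have sE : size (p ++ x :: q) = j by rewrite size_cat /= pE qE.
have yE : y = bud_out Z by move: hj; rewrite uE' onth_at // => -[].
have E1 : bud_in (bud_comp X i Y) = (p ++ bud_in Y ++ q) ++ y :: r.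
  by rewrite bud_in_comp // uE subst_at // -!catA.
have s1 : size (p ++ bud_in Y ++ q) = (j + size (bud_in Y)).-1.
  by rewrite !size_cat; lia.
have E2 : bud_in (bud_comp X j Z) = p ++ x :: (q ++ bud_in Z ++ r).
  by rewrite bud_in_comp // uE' subst_at // -catA.
have h1 : onth (bud_in (bud_comp X i Y)) (j + size (bud_in Y)).-1 =
    Some (bud_out Z) by rewrite E1 onth_at // yE.
have h2 : onth (bud_in (bud_comp X j Z)) i = Some (bud_out Y).
  by rewrite E2 onth_at // xE.
apply: bud_inP; rewrite ?bud_out_comp ?bud_op_comp //.
  by rewrite size_bud_in ocompAC //; apply: bud_op_onth.
by rewrite (bud_in_comp h1) (bud_in_comp h2) E1 E2 !subst_at // -!catA.
Qed.

Definition Bud : coloredOperad C :=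
  @ColoredOperad C bud bud_out bud_in bud_unit bud_comp
    bud_in_gt0 (fun=> erefl) (fun=> erefl) bud_out_comp bud_in_comp
    bud_comp1x bud_compx1 bud_compA bud_compAC.

End Bud.

Record budSystem (O : operad) (C : finType) := BudSystem {
  rules : {fset Bud C O};
  initial : {set C};
  terminal : {set C}
}.

Section Series.
Variables (K : fieldType) (C : finType) (P : coloredOperad C).

Definition charser (S : set P) : P -> K := fun x => (x \in S)%:R.

Definition userie : P -> K := charser (range (ounit P)).

(* The sum has finite support when P is locally finite. *)
Definition odot (f h : P -> K) : P -> K := fun x =>
  \sum_(p \in [set p : P * seq P |
                map (@out C P) p.2 = inp p.1 /\ fcomp p.1 p.2 = x])
    f p.1 * \prod_(z <- p.2) h z.

(* Two-sided inverse for [odot] (0 when there is none). *)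
Definition oinv (f : P -> K) : P -> K :=
  xget (fun=> 0) [set g : P -> K | odot f g = userie /\ odot g f = userie].

End Series.

Section Synt.
Variables (K : fieldType) (O : operad) (C : finType) (B : budSystem O C).

Definition rserie : Bud C O -> K := charser K [set` rules B].
Definition iserie : Bud C O -> K :=
  charser K [set ounit (Bud C O) a | a in [set` initial B]].
Definition tserie : Bud C O -> K :=
  charser K [set ounit (Bud C O) a | a in [set` terminal B]].

Definition synt : Bud C O -> K :=
  odot (odot iserie (oinv (@userie K C (Bud C O) \- rserie))) tserie.

Definition unambiguous : Prop := forall x, synt x = 0 \/ synt x = 1.

End Synt.

(* Commutative formal power series with variables indexed by V: a monomial is
    its vector of exponents {ffun V -> nat}, and a series is the function
    giving its coefficients. *)

Definition mps (V : finType) (K : fieldType) := {ffun V -> nat} -> K.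

HB.instance Definition _ V K :=
  GRing.Lmodule.copy (mps V K) ({ffun V -> nat} -> K^o).

Section PowerSeries.
Variables (V : finType) (K : fieldType).
Implicit Types (s t : mps V K) (m : {ffun V -> nat}).

Definition mps_one : mps V K := fun m => (m == 0)%:R.

Definition mps_mul s t : mps V K := fun m =>
  \sum_(p \in [set p : {ffun V -> nat} * {ffun V -> nat} | p.1 + p.2 = m])
    s p.1 * t p.2.

Definition mps_bnd N (b : {ffun V -> 'I_N.+1}) : {ffun V -> nat} := [ffun v => b v : nat].

Lemma mps_bndP N m : (forall v, m v <= N)%N -> exists b, m = @mps_bnd N b.
Proof.
move=> h; exists [ffun v => inord (m v)].
by apply/ffunP => v; rewrite !ffunE inordK // ltnS.
Qed.

Lemma mps_bnd_inj N : injective (@mps_bnd N).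
Proof.
move=> b c /ffunP h; apply/ffunP => v; apply/val_inj.
by have := h v; rewrite !ffunE.
Qed.

Lemma mps_mulE N s t m : (forall v, m v <= N)%N ->
  mps_mul s t m = \sum_(b : {ffun V -> 'I_N.+1}) \sum_(c : {ffun V -> 'I_N.+1})
    (mps_bnd b + mps_bnd c == m)%:R * (s (mps_bnd b) * t (mps_bnd c)).
Proof.
move=> hm; rewrite pair_big /= [RHS](eq_bigr (fun p =>
  if mps_bnd p.1 + mps_bnd p.2 == m then s (mps_bnd p.1) * t (mps_bnd p.2) else 0)); last first.
  by move=> p _; case: eqP => _; rewrite ?mul1r ?mul0r.
rewrite -big_mkcond /=.
pose h (p : {ffun V -> 'I_N.+1} * {ffun V -> 'I_N.+1}) := (mps_bnd p.1, mps_bnd p.2).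
rewrite /mps_mul.
rewrite (@reindex_fsbig _ _ _ _ _ h [set` [pred p | mps_bnd p.1 + mps_bnd p.2 == m]]
           [set p | p.1 + p.2 = m] (fun p => s p.1 * t p.2)).
  rewrite fsbig_finite //= -[RHS]big_filter.
  apply: perm_big; apply: uniq_perm.
  - exact: fset_uniq.
  - by rewrite filter_uniq ?index_enum_uniq.
  - by move=> p; rewrite in_fset_set // mem_filter mem_index_enum andbT mem_setE.
split=> [p /eqP //|p q _ _ [] /mps_bnd_inj h1 /mps_bnd_inj h2|].
  by case: p q h1 h2 => [? ?] [? ?] /= -> ->.
move=> [b c] /= bcE.
have bE : forall v, (b v + c v)%N = m v by move=> v; rewrite -bcE ffunE.
have [b' b'E] : exists b', b = @mps_bnd N b'.
  by apply: mps_bndP => v; rewrite (leq_trans _ (hm v)) // -bE leq_addr.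
have [c' c'E] : exists c', c = @mps_bnd N c'.
  by apply: mps_bndP => v; rewrite (leq_trans _ (hm v)) // -bE leq_addl.
by exists (b', c') => /=; [apply/eqP; rewrite -b'E -c'E | rewrite /h /= -b'E -c'E].
Qed.

Lemma mps_mbound m v : (m v <= \sum_w m w)%N.
Proof. by rewrite (bigD1 v) //= leq_addr. Qed.

Lemma mps_bnd_le N (b : {ffun V -> 'I_N.+1}) v : (mps_bnd b v <= N)%N.
Proof. by rewrite ffunE -ltnS. Qed.

Definition mps_mulE' N s t (m : {ffun V -> 'I_N.+1}) := @mps_mulE N s t (mps_bnd m) (mps_bnd_le m).

Lemma mps_mulC : commutative mps_mul.
Proof.
move=> s t; apply/funext => m; rewrite !(mps_mulE _ _ (mps_mbound m)) exchange_big /=.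
by apply: eq_bigr => c _; apply: eq_bigr => b _; rewrite addrC [s _ * _]mulrC.
Qed.

Lemma mps_mul1s : left_id mps_one mps_mul.
Proof.
move=> s; apply/funext => m; have [N hm] : exists N, forall v, (m v <= N)%N.
  by exists (\sum_w m w)%N; exact: mps_mbound.
rewrite (mps_mulE _ _ hm); have [n ->] := mps_bndP hm.
have [z zE] : exists z, 0 = @mps_bnd N z by apply: mps_bndP => v; rewrite ffunE.
rewrite (bigD1 z) //= (bigD1 n) //= /mps_one -zE add0r !eqxx !mul1r.
rewrite !big1 ?addr0 //.
- move=> b /negPf bz; rewrite big1 // => c _.
  by rewrite zE (inj_eq (@mps_bnd_inj _)) bz mul0r mulr0.
- move=> c /negPf cn; by rewrite add0r (inj_eq (@mps_bnd_inj _)) cn mul0r.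
Qed.

Lemma mps_mulDl : left_distributive mps_mul +%R.
Proof.
move=> s t u; apply/funext => m.
transitivity (mps_mul s u m + mps_mul t u m); last by [].
rewrite !(mps_mulE _ _ (mps_mbound m)) -big_split /=.
apply: eq_bigr => b _; rewrite -big_split /=; apply: eq_bigr => c _.
by rewrite -mulrDr -mulrDl.
Qed.

Lemma mps_mulA : associative mps_mul.
Proof.
move=> s t u; apply/funext => m; set N := (\sum_w m w)%N.
have hm v : (m v <= N)%N := mps_mbound m v.
pose T := \sum_(b : {ffun V -> 'I_N.+1}) \sum_(c : {ffun V -> 'I_N.+1})
   \sum_(d : {ffun V -> 'I_N.+1}) (mps_bnd b + mps_bnd c + mps_bnd d == m)%:R *
     (s (mps_bnd b) * t (mps_bnd c) * u (mps_bnd d)).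
have addm_pick (e d : {ffun V -> nat}) (A : K) :
    \sum_(p : {ffun V -> 'I_N.+1}) (e == mps_bnd p)%:R * ((mps_bnd p + d == m)%:R * A) =
    (e + d == m)%:R * A.
  have [le_em|gt_em] := boolP [forall v, (e v <= N)%N].
    have /mps_bndP [n ->] : forall v, (e v <= N)%N by apply/forallP.
    rewrite (bigD1 n) //= eqxx mul1r big1 ?addr0 // => p pn.
    by rewrite eq_sym (inj_eq (@mps_bnd_inj _)) (negPf pn) mul0r.
  move: gt_em; rewrite negb_forall => /existsP [v]; rewrite -ltnNge => hv.
  rewrite big1 => [|p _].
    case: eqP => [/ffunP /(_ v)|]; rewrite ?mul0r // ffunE => E.
    by move: hv; rewrite ltnNge (leq_trans _ (hm v)) // -E leq_addr.
  case: eqP => [E|]; rewrite ?mul0r //.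
  by move: hv; rewrite E => /(leq_ltn_trans (mps_bnd_le p v)); rewrite ltnn.
transitivity T; last first.
  apply: esym; rewrite (mps_mulE _ _ hm) /=.
  under eq_bigr => p _ do under eq_bigr => d _ do
    rewrite mps_mulE' mulr_suml mulr_sumr.
  under eq_bigr => p _ do under eq_bigr => d _ do
    under eq_bigr => b _ do rewrite mulr_suml mulr_sumr.
  under eq_bigr => p _ do rewrite exchange_big /=.
  rewrite exchange_big /=; apply: eq_bigr => b _.
  under eq_bigr => p _ do rewrite exchange_big /=.
  rewrite exchange_big /=; apply: eq_bigr => c _.
  rewrite exchange_big /=; apply: eq_bigr => d _.
  rewrite -addm_pick; apply: eq_bigr => p _.
  by rewrite [RHS]mulrCA !mulrA.
rewrite (mps_mulE _ _ hm) /=; apply: eq_bigr => b _.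
under eq_bigr => p _ do rewrite mps_mulE' !mulr_sumr.
rewrite exchange_big /=; apply: eq_bigr => c _.
under eq_bigr => p _ do rewrite !mulr_sumr.
rewrite exchange_big /=; apply: eq_bigr => d _.
rewrite -addrA [mps_bnd b + _]addrC -addm_pick; apply: eq_bigr => p _.
by rewrite [mps_bnd b + _]addrC [RHS]mulrCA -mulrA; congr (_ * _); rewrite mulrCA.
Qed.

Lemma mps_one_neq0 : mps_one != 0.
Proof.
apply/eqP => /(congr1 (fun s : mps V K => s 0)).
by rewrite /mps_one eqxx => /eqP; rewrite oner_eq0.
Qed.

HB.instance Definition _ := GRing.Zmodule_isComNzRing.Build (mps V K)
  mps_mulA mps_mulC mps_mul1s mps_mulDl mps_one_neq0.

Definition monomial (e : {ffun V -> nat}) : mps V K := fun m => (m == e)%:R.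

Definition variable (v : V) : mps V K := monomial [ffun w => (w == v) : nat].

(* Substitution of the series f_v for the variables of a polynomial p, i.e. of
   a series with finite support. *)
Definition poly_subst (W : finType) (p : mps W K) (f : W -> mps V K) : mps V K :=
  \sum_(m \in [set m | p m != 0]) p m *: \prod_(w : W) f w ^+ m w.

End PowerSeries.

Section ColorTypes.
Variables (K : fieldType) (C : finType).

Definition type_of (u : seq C) : {ffun C -> nat} := [ffun c => count_mem c u].

Definition is_type (al : {ffun C -> nat}) : Prop := al <> 0.

(* The word c_1^al_1 ... c_k^al_k, for the enumeration c_1, ..., c_k of C. *)
Definition type_word (al : {ffun C -> nat}) : seq C :=
  flatten [seq nseq (al c) c | c <- enum C].

Definition nonempty_word_on (A : {set C}) (u : seq C) : Prop :=
  u <> [::] /\ {subset u <= A}.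

(* Exponents of the monomial x_a Y^al, the variables x_c being indexed by [inl c]
   and the variables y_c by [inr c]. *)
Definition xymon (a : C) (al : {ffun C -> nat}) : {ffun C + C -> nat} :=
  [ffun v => match v with inl c => (c == a) : nat | inr c => al c end].

(* colt(h) is given coefficientwise; the sum has finite support when P is
   locally finite. *)
Definition colt (P : coloredOperad C) (h : P -> K) : mps (C + C)%type K := fun m =>
  \sum_(x \in [set x : P | xymon (out x) (type_of (inp x)) = m]) h x.

Definition gpoly (O : operad) (B : budSystem O C) (a : C) : mps C K :=
  \sum_(r <- rules B | out r == a) monomial K (type_of (inp r)).

(* f_a = y_a + g_a(f) for every color a.  Without the condition on the constant
   terms the solution is not unique: f = y + f^2 has one solution with constant
   term 0 and one with constant term 1, and the former is the one meant by
   "the" solution. *)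
Definition color_system_solution (O : operad) (B : budSystem O C)
    (f : C -> mps C K) : Prop :=
  (forall a, f a 0 = 0) /\
  (forall a, f a = variable K a + poly_subst (gpoly B a) f).

End ColorTypes.

(* Main.v *)
Require Import Defs.
From HB Require Import structures.
From mathcomp Require Import all_boot all_algebra.
From mathcomp Require Import finmap.
From mathcomp Require Import boolp classical_sets functions cardinality fsbigop.
From mathcomp Require Import zify.
Set Implicit Arguments.
Unset Strict Implicit.
Unset Printing Implicit Defensive.
Import GRing.Theory.
Local Open Scope classical_set_scope.
Local Open Scope ring_scope.

(** Write [u] for the unit series and [r] for the characteristic series of the
rules.  The inverse [s] of [u - r] satisfies [s = u + r (.) s] (the composition
product is linear on the left): its coefficient at [x] counts the trees of rules
that evaluate to [x].  For a color [a], let [F a] be the power series in the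
variables [y_c] whose coefficient at [al] is the sum of [s x] over the elements
[x] with output color [a] and input type [al].  Sorting the terms of [r (.) s]
by their root rule [y] turns each rule into the product of the series [F c],
for [c] ranging over the input colors of [y] ([prod_color_part],
[color_part_odot_charser]).  So [F a = y_a + g_a(F)], that is, [F] solves the
same system as [f], also with zero constant terms.  On the other hand, composing
with [i] on the left and with [t] on the right only restricts a series to the
elements with output color in [I] and input colors in [T] ([odot_unitsl],
[odot_unitsr]), so that [F a] and the series of color types of the syntactic
series have the same coefficient in the situation of the theorem.

Two points need an argument: that the inverse exists, and that the system has
only one solution.  Both are inductions along a root rule.  If this rule has
arity at least 2, then the arity (or the degree of the monomial) decreases; if
it is a rule from the color [a] to the color [b] of arity 1, then a rank on the
colors decreases.  This rank exists because the graph of the rules of arity 1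
has no cycle ([unary_rank]): turning around a cycle would yield infinitely many
trees with values of arity 1, hence, by local finiteness, infinitely many trees
with the same value, against finite factorization.

The induction gives existence and uniqueness for the equation
[h = w + r (.) h].  The solution [g] for [w = u] is a right inverse of [u - r].
It is also a left inverse: by associativity of the composition product
([odotA]), both [g (.) (u - r)] and [u] solve [h = (u - r) + r (.) h]. *)

(** * Complete composition in a colored operad *)

Section Composition.
Variables (C : finType) (P : coloredOperad C).
Implicit Types (x y z : P) (p q : seq C).

(** Graft the sequence [ys] onto the inputs [k], [k + 1], ... of [x], the last
one first.  The complete composition is the case [k = 0]; the general case is
what inductions on [ys] need. *)
Definition graft k x (ys : seq P) : P :=
  foldr (fun iy z => ocomp z iy.1 iy.2) x (zip (iota k (size ys)) ys).

Lemma graft_cons k x y ys :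
  graft k x (y :: ys) = ocomp (graft k.+1 x ys) k y.
Proof. by []. Qed.

Lemma onth_cat_size (T : Type) (p q : seq T) a : onth (p ++ a :: q) (size p) = Some a.
Proof. by rewrite onth_cat ltnn subnn. Qed.

Lemma subst_cat_size (T : Type) (p q v : seq T) a :
  take (size p) (p ++ a :: q) ++ v ++ drop (size p).+1 (p ++ a :: q) = p ++ v ++ q.
Proof. by rewrite take_size_cat // -cat_rcons drop_size_cat // size_rcons. Qed.

Lemma graft_out_inp x ys p q : inp x = p ++ map (@out C P) ys ++ q ->
  out (graft (size p) x ys) = out x /\
  inp (graft (size p) x ys) = p ++ flatten (map (@inp C P) ys) ++ q.
Proof.
elim: ys p => [|y ys IH] p E; first by [].
have [] := IH (rcons p (out y)); first by rewrite E cat_rcons.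
rewrite size_rcons graft_cons => Eo Ei.
have h : onth (inp (graft (size p).+1 x ys)) (size p) = Some (out y).
  by rewrite Ei cat_rcons onth_cat_size.
split; first by rewrite out_ocomp.
by rewrite inp_ocomp // Ei cat_rcons subst_cat_size /= -catA.
Qed.

Lemma graft_inp x ys p q : inp x = p ++ map (@out C P) ys ++ q ->
  inp (graft (size p) x ys) = p ++ flatten (map (@inp C P) ys) ++ q.
Proof. by case/graft_out_inp. Qed.

Lemma graft_out x ys p q : inp x = p ++ map (@out C P) ys ++ q ->
  out (graft (size p) x ys) = out x.
Proof. by case/graft_out_inp. Qed.

Lemma out_fcomp x ys : map (@out C P) ys = inp x -> out (fcomp x ys) = out x.
Proof. by move=> E; apply: (@graft_out x ys [::] [::]); rewrite cats0 E. Qed.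

Lemma inp_fcomp x ys : map (@out C P) ys = inp x ->
  inp (fcomp x ys) = flatten (map (@inp C P) ys).
Proof.
by move=> E; rewrite (@graft_inp x ys [::] [::]) ?cats0 // E.
Qed.

Lemma arity_fcomp x ys : map (@out C P) ys = inp x ->
  arity (fcomp x ys) = (\sum_(y <- ys) arity y)%N.
Proof.
move=> E; rewrite /arity inp_fcomp // size_flatten /shape -map_comp sumnE.
by rewrite big_map.
Qed.

Lemma arity_gt0 x : (0 < arity x)%N. Proof. exact: inp_gt0. Qed.

(** Grafting onto the inputs of [x o_k y] that come from [y]: iterated
associativity in series. *)
Lemma graft_ocomp_in x y zs p q p' q' :
  inp x = p ++ out y :: q -> inp y = p' ++ map (@out C P) zs ++ q' ->
  graft (size p + size p') (ocomp x (size p) y) zs =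
  ocomp x (size p) (graft (size p') y zs).
Proof.
move=> Ex; elim: zs p' => [|z zs IH] p' Ey; first by [].
have Ey' : inp y = rcons p' (out z) ++ map (@out C P) zs ++ q'.
  by rewrite cat_rcons.
have := IH _ Ey'; rewrite !graft_cons size_rcons addnS => ->.
have [] := graft_out_inp Ey'; rewrite size_rcons => Eo Ei; rewrite ocompA //.
- by rewrite Ex Eo onth_cat_size.
- by rewrite Ei cat_rcons onth_cat_size.
Qed.

(** Grafting onto inputs of [x o_k y] that come from [x] and lie to the right of
[y]: iterated associativity in parallel. *)
Lemma graft_ocomp_right x y zs p p' q :
  inp x = p ++ out y :: p' ++ map (@out C P) zs ++ q ->
  graft (size p + arity y + size p') (ocomp x (size p) y) zs =
  ocomp (graft (size p + size p').+1 x zs) (size p) y.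
Proof.
elim: zs p' => [|z zs IH] p' E; first by [].
have E' : inp x = p ++ out y :: rcons p' (out z) ++ map (@out C P) zs ++ q.
  by rewrite cat_rcons.
have /= := IH _ E'; rewrite !graft_cons size_rcons !addnS => ->.
have Ei : inp (graft (size p + size p').+2 x zs) =
    p ++ out y :: p' ++ out z :: flatten (map (@inp C P) zs) ++ q.
  have := @graft_inp x zs (p ++ out y :: rcons p' (out z)) q.
  rewrite size_cat /= size_rcons !addnS -catA /= => ->; last by rewrite E'.
  by rewrite -!catA /= cat_rcons.
rewrite -[RHS]ocompAC.
- congr (ocomp _ _ _); rewrite /arity; lia.
- lia.
- by rewrite Ei onth_cat_size.
- rewrite Ei; have := onth_cat_size (p ++ out y :: p')
    (flatten (map (@inp C P) zs) ++ q) (out z).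
  by rewrite size_cat /= addnS -catA.
Qed.

(** The sequence [qs] lists the pairs [(y, zs)] of an element grafted onto [x]
and of the elements then grafted onto it. *)
Lemma graft_assoc x (qs : seq (P * seq P)) p q :
    (forall r, r \in qs -> map (@out C P) r.2 = inp r.1) ->
    inp x = p ++ map (@out C P) (map fst qs) ++ q ->
  graft (size p) (graft (size p) x (map fst qs)) (flatten (map snd qs)) =
  graft (size p) x [seq fcomp r.1 r.2 | r <- qs].
Proof.
elim: qs p => [|[y zs] qs IH] p Hq E; first by [].
have Hq' r : r \in qs -> map (@out C P) r.2 = inp r.1.
  by move=> rq; apply: Hq; rewrite inE rq orbT.
have Eyz : map (@out C P) zs = inp y by apply: (Hq (y, zs)); rewrite inE eqxx.
have E' : inp x = rcons p (out y) ++ map (@out C P) (map fst qs) ++ q.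
  by rewrite E cat_rcons.
have /= IHp := IH _ Hq' E'.
have cat_graft k X (us vs : seq P) :
    graft k X (us ++ vs) = graft k (graft (k + size us) X vs) us.
  elim: us k => [|u us IHu] k; first by rewrite addn0.
  by rewrite !graft_cons IHu /= addSnnS.
rewrite cat_graft /= !graft_cons.
have szs : size zs = arity y by rewrite /arity -Eyz size_map.
set X := graft (size p).+1 x _.
have Xi : inp X = p ++ out y :: flatten (map (@inp C P) (map fst qs)) ++ q.
  by rewrite /X; have := graft_inp E'; rewrite size_rcons cat_rcons.
have Ef : map (@out C P) (flatten (map snd qs)) = flatten (map (@inp C P) (map fst qs)).
  by rewrite map_flatten -!map_comp; congr flatten; apply/eq_in_map => r /Hq' /=.
have := @graft_ocomp_right X y (flatten (map snd qs)) p [::] q.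
rewrite /= !addn0 szs => ->; last by rewrite Ef.
rewrite size_rcons in IHp; rewrite IHp.
have := @graft_ocomp_in (graft (size p).+1 x [seq fcomp r.1 r.2 | r <- qs]) y zs p
  (flatten (map (@inp C P) [seq fcomp r.1 r.2 | r <- qs]) ++ q) [::] [::].
rewrite addn0 => -> //; last by rewrite cats0 Eyz.
have := @graft_inp x [seq fcomp r.1 r.2 | r <- qs] (rcons p (out y)) q.
rewrite size_rcons => ->; first by rewrite cat_rcons.
rewrite E' -!map_comp; congr (_ ++ _ ++ _).
by apply/eq_in_map => r /Hq' /= /out_fcomp.
Qed.

Lemma fcompA x (qs : seq (P * seq P)) :
    (forall r, r \in qs -> map (@out C P) r.2 = inp r.1) ->
    map (@out C P) (map fst qs) = inp x ->
  fcomp (fcomp x (map fst qs)) (flatten (map snd qs)) =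
  fcomp x [seq fcomp r.1 r.2 | r <- qs].
Proof.
by move=> Hq E; apply: (@graft_assoc x qs [::] [::]) => //; rewrite cats0 E.
Qed.

Lemma fcompx1 x : fcomp x (map (@ounit C P) (inp x)) = x.
Proof.
suff H p u : inp x = p ++ u -> graft (size p) x (map (@ounit C P) u) = x.
  exact: (H [::]).
elim: u p => [|a u IH] p E //=; rewrite graft_cons.
have := IH (rcons p a); rewrite size_rcons cat_rcons => -> //.
by rewrite ocompx1 // E onth_cat_size.
Qed.

Lemma fcomp1x x : fcomp (ounit P (out x)) [:: x] = x.
Proof. exact: ocomp1x. Qed.

End Composition.

(** * Finitely supported sums *)

Lemma finite_seqs_le (T : choiceType) (A : set T) n : finite_set A ->
  finite_set [set s : seq T | (size s <= n)%N /\ forall x, x \in s -> A x].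
Proof.
move=> finA; elim: n => [|n IH].
  apply: (@sub_finite_set _ _ [set [::]]); last exact: finite_set1.
  by case=> [|x s] [].
apply: (@sub_finite_set _ _ ([set [::]] `|`
    (fun u : T * seq T => u.1 :: u.2) @`
      (A `*` [set s : seq T | (size s <= n)%N /\ forall x, x \in s -> A x]))).
  case=> [|x s] /=; first by left.
  move=> [sn sA]; right; exists (x, s) => //=; split=> /=.
    by apply: sA; rewrite inE eqxx.
  by split=> // y ys; apply: sA; rewrite inE ys orbT.
rewrite finite_setU; split; first exact: finite_set1.
by apply: finite_image; apply: finite_setX.
Qed.

Lemma fsum_sigma (R : nmodType) (I J : choiceType) (A : set I) (B : I -> set J)
    (F : I -> J -> R) :
  finite_set A -> (forall i, A i -> finite_set (B i)) ->
  \sum_(i \in A) \sum_(j \in B i) F i j = \sum_(u \in A `*`` B) F u.1 u.2.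
Proof.
move=> finA finB; set D := \bigcup_(i in A) B i.
have finD : finite_set D by exact: bigcup_finite.
transitivity (\sum_(i \in A) \sum_(j \in D) if j \in B i then F i j else 0).
  apply: eq_fsbigr => i; rewrite inE => Ai; rewrite -fsbig_mkcondr.
  by apply: eq_fsbigl; rewrite setIidr // => j Bij; exists i.
rewrite pair_fsbig //.
transitivity (\sum_(u \in A `*` D)
    if u \in [set u | B u.1 u.2] then F u.1 u.2 else 0).
  by apply: eq_fsbigr => u _; congr (if _ then _ else _).
rewrite -fsbig_mkcondr; apply: eq_fsbigl; apply/seteqP.
split=> [u [[Au Du] Bu]|u [Au Bu]].
  by [].
by split=> //; split=> //; exists u.1.
Qed.

(** The sequences [js] with the same size as [s] whose k-th item belongs to
[A i], where [i] is the k-th item of [s]. *)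
Fixpoint selection (I J : Type) (A : I -> set J) (s : seq I) (js : seq J) : Prop :=
  match s, js with
  | [::], [::] => True
  | i :: s', j :: js' => A i j /\ selection A s' js'
  | _, _ => False
  end.

Lemma finite_selection (I J : choiceType) (A : I -> set J) s :
  (forall i, finite_set (A i)) -> finite_set (selection A s).
Proof.
move=> finA; elim: s => [|i s IH].
  apply: (@sub_finite_set _ _ [set [::]]); last exact: finite_set1.
  by case.
apply: (@sub_finite_set _ _ ((fun u : J * seq J => u.1 :: u.2) @`
      (A i `*` selection A s))).
  by case=> [|j js] //= [Aj sjs]; exists (j, js).
by apply: finite_image; apply: finite_setX.
Qed.

(** Generalized distributivity. *)
Lemma prod_fsum (R : idomainType) (I J : choiceType) (A : I -> set J)
    (F : J -> R) (s : seq I) : (forall i, finite_set (A i)) ->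
  \prod_(i <- s) \sum_(j \in A i) F j =
  \sum_(js \in selection A s) \prod_(j <- js) F j.
Proof.
move=> finA; elim: s => [|i s IH].
  rewrite big_nil (_ : selection A [::] = [set [::]]) ?fsbig_set1 ?big_nil //.
  by apply/seteqP; split=> [[]|_ ->].
rewrite big_cons IH mulr_fsuml.
under eq_fsbigr do rewrite mulr_fsumr.
rewrite pair_fsbig; [|exact: finA|exact: finite_selection].
rewrite (@reindex_fsbig _ _ _ _ _ (fun u : J * seq J => u.1 :: u.2)
  (A i `*` selection A s)).
  by apply: eq_fsbigr => u _; rewrite big_cons.
split=> [u [] //|[j js] [j' js'] _ _ [-> ->] //|].
by case=> [|j js] //= [Aj sjs]; exists (j, js).
Qed.

(** * Associativity of the composition product *)

Section Odot.
Variables (K : fieldType) (C : finType) (P : coloredOperad C).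
Hypothesis Pfin : locally_finite P.
Implicit Types (f g h : P -> K) (x y z : P).

(** The ways to write [x] as a complete composition [y o [z_1, ..., z_n]]. *)
Definition decompositions x : set (P * seq P) :=
  [set p | map (@out C P) p.2 = inp p.1 /\ fcomp p.1 p.2 = x].

Lemma finite_arity_le n : finite_set [set x : P | (arity x <= n)%N].
Proof.
apply: (@sub_finite_set _ _ (\bigcup_(i in `I_n.+1) [set x : P | arity x = i])).
  by move=> x /= xn; exists (arity x).
by apply: bigcup_finite => [|i _]; [exact: finite_II | exact: Pfin].
Qed.

Lemma size_le_sum_arity (zs : seq P) : (size zs <= \sum_(z <- zs) arity z)%N.
Proof.
by rewrite -sum1_size; apply: leq_sum => z _; exact: arity_gt0.
Qed.

Lemma mem_le_sum (T : eqType) (zs : seq T) (F : T -> nat) (z : T) : z \in zs ->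
  (F z <= \sum_(z <- zs) F z)%N.
Proof. by move=> zzs; rewrite (big_rem z) //= leq_addr. Qed.

Lemma finite_decompositions x : finite_set (decompositions x).
Proof.
apply: (@sub_finite_set _ _ ([set y : P | (arity y <= arity x)%N] `*`
  [set s : seq P | (size s <= arity x)%N /\
     forall z, z \in s -> (arity z <= arity x)%N])).
  case=> y zs [/= Eo <-]; rewrite arity_fcomp //; split=> /=.
    by rewrite /arity -Eo size_map size_le_sum_arity.
  by split; [exact: size_le_sum_arity | move=> z; exact: mem_le_sum].
apply: finite_setX; first exact: finite_arity_le.
exact/finite_seqs_le/finite_arity_le.
Qed.

Lemma odotE f h x : odot f h x =
  \sum_(p \in decompositions x) f p.1 * \prod_(z <- p.2) h z.
Proof. by []. Qed.

Lemma selection_decompositions us (qs : seq (P * seq P)) :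
  selection decompositions us qs <->
  (forall q, q \in qs -> map (@out C P) q.2 = inp q.1) /\
  [seq fcomp q.1 q.2 | q <- qs] = us.
Proof.
elim: us qs => [|u us IH] [|q qs] /=; try by split=> [|[_]].
split=> [[[Eq Fq] /IH [Eqs Fqs]]|[H [Fq Fqs]]].
  by split=> [r|]; [rewrite inE => /orP [/eqP ->|/Eqs] | rewrite Fq Fqs].
split; first by split=> //; apply: H; rewrite inE eqxx.
by apply/IH; split=> // r rq; apply: H; rewrite inE rq orbT.
Qed.

(** Both sides sum over the two-level compositions
[y o [v_1 o zs_1, ..., v_n o zs_n]] of [x]. *)
Lemma odotA f g h : odot (odot f g) h = odot f (odot g h).
Proof.
have findec := finite_decompositions.
apply/funext => x; rewrite !odotE.
under eq_fsbigr do rewrite odotE mulr_fsuml.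
rewrite fsum_sigma //.
under [RHS]eq_fsbigr do under eq_bigr do rewrite odotE.
under [RHS]eq_fsbigr do rewrite prod_fsum // mulr_fsumr.
rewrite [RHS]fsum_sigma //; last by move=> p _; exact: finite_selection.
(* The right-hand side records [y] and the pairs [(v_i, zs_i)]; the left-hand
   side records [y o [v_1, ..., v_n]], the concatenation of the [zs_i], and [y]
   with the [v_i]. *)
pose psi (v : (P * seq P) * seq (P * seq P)) :=
  ((fcomp v.1.1 (map fst v.2), flatten (map snd v.2)), (v.1.1, map fst v.2)).
rewrite (@reindex_fsbig _ _ _ _ _ psi
  (decompositions x `*`` (fun p => selection decompositions p.2))).
  apply: eq_fsbigr => -[[y us] qs] _ /=.
  by rewrite big_map big_flatten /= big_map -mulrA big_split.
split.
- move=> [[y us] qs] [/= [Eo Ex]] /selection_decompositions [Hq Fq].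
  rewrite /= in Eo Ex.
  have Eo' : map (@out C P) (map fst qs) = inp y.
    rewrite -Eo -Fq -!map_comp; apply/eq_in_map => q /Hq /= Hq'.
    by rewrite out_fcomp.
  split=> //; split=> /=; last by rewrite fcompA // Fq.
  rewrite inp_fcomp // map_flatten -!map_comp; congr flatten.
  by apply/eq_in_map => q /Hq.
- move=> [[y us] qs] [[y' us'] qs']; rewrite !inE /=.
  move=> [_ /= /selection_decompositions [Hq Fq]].
  move=> [_ /= /selection_decompositions [Hq' Fq']].
  rewrite /psi /= => -[_ Efl Ey Ef].
  have Eshape (rs : seq (P * seq P)) :
      (forall q, q \in rs -> map (@out C P) q.2 = inp q.1) ->
      shape (map snd rs) = map (@arity C P) (map fst rs).
    move=> Hrs; rewrite /shape -!map_comp; apply/eq_in_map => q /Hrs /=.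
    by rewrite /arity => <-; rewrite size_map.
  (* The arities of the [v_i] tell where to cut the concatenation. *)
  have Eqs : qs = qs'.
    rewrite -[LHS]zip_unzip -[RHS]zip_unzip /unzip1 /unzip2 Ef; congr zip.
    by rewrite -[LHS]flattenK -[RHS]flattenK Efl !Eshape ?Ef.
  by rewrite Ey -Fq -Fq' Eqs.
- move=> [[w zs] [y vs]] [/= [/= Ew Ex] [/= Ey Fw]].
  pose qs := zip vs (reshape (map (@arity C P) vs) zs).
  have Einp : map (@out C P) zs = flatten (map (@inp C P) vs).
    by rewrite Ew -Fw inp_fcomp.
  have Esz : sumn (map (@arity C P) vs) = size zs.
    rewrite -(size_map (@out C P) zs) Einp size_flatten /shape -map_comp.
    by [].
  have Erz : size (reshape (map (@arity C P) vs) zs) = size vs.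
    by rewrite size_reshape size_map.
  have E1 : map fst qs = vs by rewrite -/(unzip1 _) unzip1_zip // Erz.
  have E2 : map snd qs = reshape (map (@arity C P) vs) zs.
    by rewrite -/(unzip2 _) unzip2_zip // Erz.
  have Hq q : q \in qs -> map (@out C P) q.2 = inp q.1.
    have : map (fun q => map (@out C P) q.2) qs = map (fun q => inp q.1) qs.
      rewrite (map_comp (map (@out C P)) snd) (map_comp (@inp C P) fst) E1 E2.
      rewrite map_reshape Einp -[RHS]flattenK; congr reshape.
      by rewrite /shape -map_comp.
    by move/eq_in_map; apply.
  have Efl : flatten (map snd qs) = zs by rewrite E2 reshapeKr // Esz.
  exists ((y, [seq fcomp q.1 q.2 | q <- qs]), qs); last first.
    by rewrite /psi /= E1 Efl Fw.
  split=> /=; last exact/selection_decompositions.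
  split=> /=; last by rewrite -fcompA ?E1 // Efl Fw.
  rewrite -Ey -E1 -!map_comp; apply/eq_in_map => q /Hq /= Hq'.
  by rewrite out_fcomp.
Qed.

End Odot.

(** * The inverse of u - r *)

Section Inverse.
Variables (K : fieldType) (C : finType) (P : coloredOperad C).
Hypothesis Pfin : locally_finite P.
Implicit Types (f g h w : P -> K) (x y z : P) (A : set C).

Lemma ounit_inj : injective (@ounit C P).
Proof. by move=> a b /(congr1 (@out C P)); rewrite !out_ounit. Qed.

Lemma charser_ounit A a : charser K (@ounit C P @` A) (ounit P a) = (a \in A)%:R.
Proof.
rewrite /charser; congr (nat_of_bool _)%:R.
apply/idP/idP; rewrite !inE; first by case=> b Ab /ounit_inj <-.
by move=> Aa; exists a.
Qed.

Lemma userieE : userie K (P := P) = charser K (@ounit C P @` [set: C]).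
Proof. by []. Qed.

(** Only the decomposition of [x] into itself and units contributes. *)
Lemma odot_unitsr h A x :
  odot h (charser K (@ounit C P @` A)) x = h x * \prod_(c <- inp x) (c \in A)%:R.
Proof.
pose p0 : P * seq P := (x, map (@ounit C P) (inp x)).
have out_units (u : seq C) : map (@out C P) (map (@ounit C P) u) = u.
  by rewrite -map_comp map_id_in // => a _; rewrite /= out_ounit.
have Dp0 : decompositions x p0.
  by split=> /=; [exact: out_units | exact: fcompx1].
rewrite odotE (fsbigE [:: p0]) //=.
- rewrite big_cons big_nil mem_set // addr0 big_map.
  by under eq_bigr do rewrite charser_ounit.
- by move=> p /= /[!inE] /eqP ->.
move=> [y zs] [/= Eo Ex] Np; have [units_zs|] := boolP (all (mem (@ounit C P @` A)) zs).
  have Ezs : zs = map (@ounit C P) (map (@out C P) zs).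
    rewrite -map_comp -[LHS]map_id; apply/eq_in_map => z /(allP units_zs) /=.
    by rewrite inE => -[a _ <-]; rewrite out_ounit.
  have Eyx : y = x by rewrite -Ex Ezs Eo fcompx1.
  by move: Np; rewrite inE /p0 {1}Ezs Eo Eyx eqxx.
rewrite -has_predC => /hasP [z zzs /= Nz].
by rewrite (big_rem z) //= /charser (negPf Nz) mul0r mulr0.
Qed.

Lemma odot_unitsl h A x :
  odot (charser K (@ounit C P @` A)) h x = (out x \in A)%:R * h x.
Proof.
pose p0 : P * seq P := (ounit P (out x), [:: x]).
have Dp0 : decompositions x p0.
  by split=> /=; rewrite ?inp_ounit ?fcomp1x.
rewrite odotE (fsbigE [:: p0]) //=.
- by rewrite big_cons big_nil mem_set // addr0 /= charser_ounit big_seq1.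
- by move=> p /= /[!inE] /eqP ->.
move=> [y zs] [/= Eo Ex] Np.
have [|Ny] := boolP (y \in @ounit C P @` A); last by rewrite /charser (negPf Ny) mul0r.
rewrite inE => -[a _ Ea]; move: Eo Ex Np; rewrite -Ea inp_ounit.
case: zs => [|z [|z' zs]] //= -[<-]; rewrite fcomp1x => ->.
by rewrite inE eqxx.
Qed.

Lemma odot_userier h : odot h (userie K (P := P)) = h.
Proof.
apply/funext => x; rewrite userieE odot_unitsr big1 ?mulr1 // => c _.
by rewrite in_setT.
Qed.

Lemma odot_useriel h : odot (userie K (P := P)) h = h.
Proof. by apply/funext => x; rewrite userieE odot_unitsl in_setT mul1r. Qed.

Lemma odotBl f g h : odot (f \- g) h = odot f h \- odot g h.
Proof.
apply/funext => x; rewrite /= !odotE.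
rewrite (eq_fsbigr (fun p => f p.1 * \prod_(z <- p.2) h z +
    (-1) * (g p.1 * \prod_(z <- p.2) h z))); last first.
  by move=> p _; rewrite mulrBl mulN1r.
rewrite fsbig_split; last exact: finite_decompositions.
by rewrite -mulr_fsumr mulN1r.
Qed.

Lemma odotDl f g h : odot (f \+ g) h = odot f h \+ odot g h.
Proof.
apply/funext => x; rewrite /= !odotE.
rewrite -fsbig_split; last exact: finite_decompositions.
by apply: eq_fsbigr => p _; rewrite mulrDl.
Qed.

(** From here on, [mu] is a measure that decreases from an element
[y o [z_1, ..., z_n]] to the [z_i], whenever [y] is in the support of [r]. *)
Variables (r : P -> K) (mu : P -> nat).
Hypothesis mu_lt : forall x p z,
  decompositions x p -> r p.1 != 0 -> z \in p.2 -> (mu z < mu x)%N.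

Lemma odot_local h h' x : (forall z, (mu z < mu x)%N -> h z = h' z) ->
  odot r h x = odot r h' x.
Proof.
move=> E; apply: eq_fsbigr => p; rewrite inE => Dp.
have [->|rp] := eqVneq (r p.1) 0; first by rewrite !mul0r.
congr (_ * _); rewrite big_seq [RHS]big_seq; apply: eq_bigr => z zp.
by apply: E; exact: mu_lt Dp rp zp.
Qed.

Lemma odot_fixpoint_uniq w h h' :
  h = w \+ odot r h -> h' = w \+ odot r h' -> h = h'.
Proof.
move=> E E'; apply/funext => x; have [n] := ubnP (mu x).
elim: n x => // n IH x; rewrite ltnS => xn.
rewrite E E' /=; congr (_ + _); apply: odot_local => z zx.
by apply: IH; apply: leq_trans zx xn.
Qed.

(** The iterates of [h |-> w + r (.) h] are stationary at every [x], from the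
index [mu x + 1] on. *)
Lemma odot_fixpoint_exists w : exists h, h = w \+ odot r h.
Proof.
pose Phi h := w \+ odot r h.
have Phi_local h h' n : (forall z, (mu z < n)%N -> h z = h' z) ->
    forall z, (mu z < n.+1)%N -> Phi h z = Phi h' z.
  move=> E z zn; congr (_ + _); apply: odot_local => z' z'z.
  by apply: E; apply: leq_trans z'z _.
have iter_stable n m z : (mu z < n)%N -> (n <= m)%N ->
    iter m Phi (fun=> 0) z = iter n Phi (fun=> 0) z.
  elim: n m z => // n IH [|m] // z zn nm /=.
  by apply: Phi_local zn => z' z'n; exact: IH.
exists (fun x => iter (mu x).+1 Phi (fun=> 0) x); apply/funext => x /=.
congr (_ + _); apply: odot_local => z zx.
by rewrite -iterS; apply: iter_stable.
Qed.

Lemma useriesub_inverse_exists : exists g,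
  odot (userie K (P := P) \- r) g = userie K (P := P) /\
  odot g (userie K (P := P) \- r) = userie K (P := P).
Proof.
have [g Eg] := odot_fixpoint_exists (userie K (P := P)); exists g; split.
  rewrite odotBl odot_useriel; apply/funext => x /=.
  by rewrite {1}Eg /= addrK.
set s := _ \- r.
apply: (@odot_fixpoint_uniq s); last first.
  by rewrite odot_userier; apply/funext => x; rewrite /= subrK.
by rewrite {1}Eg odotDl odot_useriel odotA.
Qed.

Lemma odot_right_inverseE g : odot (userie K (P := P) \- r) g = userie K (P := P) ->
  g = userie K (P := P) \+ odot r g.
Proof.
by move=> E; apply/funext => x; rewrite /= -E odotBl odot_useriel /= subrK.
Qed.

End Inverse.

(** * Acyclicity of the rules of arity 1 *)

Section UnaryRank.
Variables (C : finType) (P : coloredOperad C).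
Hypothesis Pfin : locally_finite P.
Variable S : set P.
Hypothesis Sfact : finitely_factorizes S.

(** The length of the leftmost branch of a tree. *)
Fixpoint spine_depth (t : tree P) : nat :=
  match t with Node _ (t' :: _) => (spine_depth t').+1 | _ => 0 end.

(** There is an element of [S] of arity 1 from the color [a] to the color
[b]. *)
Definition unary_edge : rel C :=
  fun a b => `[< exists2 y, S y & out y = a /\ inp y = [:: b] >].

(** If every color of [Q] has an edge to a color of [Q], then following edges from
a color of [Q] gives trees of every depth whose value has arity 1; but there are
finitely many trees with a value of arity 1. *)
Lemma no_unary_trap (Q : set C) :
  (forall a, Q a -> exists2 b, Q b & unary_edge a b) -> forall a, ~ Q a.
Proof.
move=> Qstep a0 Qa0.
have trees n a : Q a -> exists t : tree P,
    [/\ Free S t, tree_out t = a, out (ev t) = a, arity (ev t) = 1%N &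
        spine_depth t = n].
  elim: n a => [|n IH] a Qa.
    by exists (Leaf P a); rewrite /arity /= out_ounit inp_ounit.
  have [b Qb /asboolP [y Sy [Ea Eb]]] := Qstep a Qa.
  have [t [Ft Eto Eo At Et]] := IH b Qb.
  have Eo' : map (@out C P) [:: ev t] = inp y by rewrite /= Eo Eb.
  exists (Node y [:: t]); split=> //=; rewrite ?Et //.
  - by rewrite Eto Eb.
  - by rewrite out_fcomp.
  - by rewrite arity_fcomp // big_seq1.
have finT : finite_set [set t | Free S t /\ arity (ev t) = 1%N].
  apply: (@sub_finite_set _ _ (\bigcup_(x in [set x : P | arity x = 1%N])
      [set t | Free S t /\ ev t = x])).
    by move=> t [Ft At]; exists (ev t).
  by apply: bigcup_finite => [|x _]; [exact: Pfin | exact: Sfact].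
apply: infinite_nat; apply: sub_finite_set (finite_image spine_depth finT).
by move=> n _; have [t [? ? ? ? <-]] := trees n a0 Qa0; exists t.
Qed.

(** The rank of a color is the number of colors that it reaches. *)
Lemma unary_rank : exists rank : C -> nat, (forall a, rank a <= #|C|)%N /\
  forall y b, S y -> inp y = [:: b] -> (rank b < rank (out y))%N.
Proof.
exists (fun a => #|connect unary_edge a|); split=> [a|y b Sy Eb].
  exact: max_card.
set a := out y.
have ab : unary_edge a b by apply/asboolP; exists y.
apply: proper_card; apply/properP; split.
  apply/fintype.subsetP => c; rewrite !unfold_in; exact: connect_trans (connect1 ab).
exists a; first exact: connect0.
apply/negP => ba; rewrite unfold_in in ba.
(* A cycle from [a] through [b] makes the strongly connected component of [a] a
   set in which every color has an outgoing edge. *)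
apply: (@no_unary_trap
  [set c | connect unary_edge a c /\ connect unary_edge c a]) (_ : _ a).
  move=> c [ac ca]; have [Eca|Nca] := eqVneq c a.
    by exists b; [split=> //; exact: connect1 | rewrite Eca].
  case/connectP: ca => [[|d p] /= ]; first by move=> _ E; rewrite E eqxx in Nca.
  case/andP => cd dp E; exists d => //; split.
    exact: connect_trans ac (connect1 cd).
  by apply/connectP; exists p.
by split=> /=; exact: connect0.
Qed.

End UnaryRank.

(** * Formal power series and types of words *)

Section PowerSeries.
Variables (V : finType) (K : fieldType).
Implicit Types (s t : mps V K) (m : {ffun V -> nat}).

(** The total degree of a monomial. *)
Definition mdeg m := (\sum_v m v)%N.

Lemma mdegD m1 m2 : mdeg (m1 + m2) = (mdeg m1 + mdeg m2)%N.
Proof. by rewrite /mdeg -big_split; apply: eq_bigr => v _; rewrite ffunE. Qed.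

Lemma mdeg_gt0 m : m != 0 -> (0 < mdeg m)%N.
Proof.
apply: contraNT; rewrite -leqNgt leqn0 sum_nat_eq0 => /forallP m0.
by apply/eqP/ffunP => v; rewrite ffunE; apply/eqP/m0.
Qed.

Lemma mpsM s t m :
  (s * t) m = \sum_(p \in [set p | p.1 + p.2 = m]) s p.1 * t p.2.
Proof. by []. Qed.

Lemma mps1E m : (1 : mps V K) m = (m == 0)%:R.
Proof. by []. Qed.

Lemma finite_mdecomp m :
  finite_set [set p : {ffun V -> nat} * {ffun V -> nat} | p.1 + p.2 = m].
Proof.
pose N := mdeg m.
apply: (@sub_finite_set _ _ (range (@mps_bnd V N) `*` range (@mps_bnd V N))).
  move=> [p q] /= Em; have le v : (p v <= N)%N /\ (q v <= N)%N.
    have le : (m v <= N)%N := mps_mbound m v.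
    rewrite -Em ffunE in le.
    by split; apply: leq_trans le; rewrite ?leq_addr ?leq_addl.
  by split=> /=; [have [b ->] := mps_bndP (fun v => proj1 (le v))
                 |have [b ->] := mps_bndP (fun v => proj2 (le v))]; exists b.
by apply: finite_setX; apply: finite_image; exact: finite_finset.
Qed.

Lemma mps_sumE (I : Type) (r : seq I) (A : pred I) (F : I -> mps V K) m :
  (\sum_(i <- r | A i) F i) m = \sum_(i <- r | A i) F i m.
Proof. by elim/big_rec2: _ => // i s t _ <-. Qed.

Lemma mpsM_const s t : s 0 = 0 -> (s * t) 0 = 0.
Proof.
move=> s0; rewrite mpsM; apply: fsbig1 => -[p q] /= E.
have -> : p = 0; last by rewrite s0 mul0r.
apply/ffunP => v; move/ffunP: E => /(_ v); rewrite !ffunE.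
by case: (p v).
Qed.

(** Without constant terms, a coefficient of a product of at least two series
depends only on the coefficients of lower degree of the factors. *)
Lemma prod_mps_local (f f' : V -> mps V K) m (cs : seq V) :
    (forall c, f c 0 = 0) -> (forall c, f' c 0 = 0) -> (1 < size cs)%N ->
    (forall c m', (mdeg m' < mdeg m)%N -> f c m' = f' c m') ->
  (\prod_(c <- cs) f c) m = (\prod_(c <- cs) f' c) m.
Proof.
move=> f0 f'0; elim: cs m => [|c [|d cs] IH] //= m _ E.
rewrite !(big_cons _ _ c) !mpsM; apply: eq_fsbigr => -[p q]; rewrite inE /= => Em.
have prod0 (g : V -> mps V K) : (forall c, g c 0 = 0) -> (\prod_(c <- d :: cs) g c) 0 = 0.
  by move=> g0; rewrite big_cons mpsM_const.
have [->|Np] := eqVneq p 0; first by rewrite f0 f'0 !mul0r.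
have [->|Nq] := eqVneq q 0; first by rewrite !prod0 ?mulr0.
have := mdeg_gt0 Np; have := mdeg_gt0 Nq; have := mdegD p q; rewrite Em => dm dq dp.
congr (_ * _); first by apply: E; lia.
have E' c' m' : (mdeg m' < (mdeg q).+1)%N -> f c' m' = f' c' m'.
  by move=> le; apply: E; lia.
case: cs {prod0} IH => [|d' cs] IH; first by rewrite !big_seq1; apply: E'.
by apply: IH => // c' m' le; apply: E'; lia.
Qed.

End PowerSeries.

Section ColorTypes.
Variables (K : fieldType) (C : finType).

Lemma type_of_nil : type_of ([::] : seq C) = 0.
Proof. by apply/ffunP => c; rewrite !ffunE. Qed.

Lemma type_of_cat (u v : seq C) : type_of (u ++ v) = type_of u + type_of v.
Proof. by apply/ffunP => c; rewrite !ffunE count_cat. Qed.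

Lemma mdeg_type_of (u : seq C) : mdeg (type_of u) = size u.
Proof.
elim: u => [|c u IH].
  by rewrite type_of_nil /mdeg big1 // => v _; rewrite ffunE.
rewrite -cat1s type_of_cat mdegD IH /mdeg (bigD1 c) //= big1 ?ffunE /= ?eqxx //.
by move=> v vc; rewrite ffunE /= eq_sym (negPf vc).
Qed.

Lemma monomial_type_ofM (f : C -> mps C K) (cs : seq C) :
  \prod_c f c ^+ type_of cs c = \prod_(c <- cs) f c.
Proof.
elim: cs => [|c cs IH].
  by rewrite big_nil big1 // => c _; rewrite ffunE.
rewrite big_cons -IH -cat1s type_of_cat.
under eq_bigr do rewrite ffunE exprD.
rewrite big_split; congr (_ * _).
rewrite (bigD1 c) //= big1 ?mulr1 ?ffunE /= ?eqxx // => d dc.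
by rewrite ffunE /= eq_sym (negPf dc).
Qed.

(** Several rules may have the same output color and input type, so the
coefficients of [g_a] are sums over rules. *)
Lemma poly_subst_gpoly (O : operad) (B : budSystem O C) (f : C -> mps C K) a :
  poly_subst (gpoly K B a) f =
  \sum_(r <- rules B | out r == a) \prod_(c <- inp r) f c.
Proof.
pose M (m : {ffun C -> nat}) : mps C K := \prod_(w : C) f w ^+ m w.
set p := gpoly K B a.
have pE m : p m = \sum_(r <- rules B | out r == a) (m == type_of (inp r))%:R.
  by rewrite /p /gpoly mps_sumE.
pose T := undup [seq type_of (inp r) | r <- rules B].
have Tsupp m : m \notin T -> p m = 0.
  rewrite mem_undup => Nm; rewrite pE big_seq_cond big1 // => r /andP [rB _].
  by case: eqP => // E; case/negP: Nm; apply/mapP; exists r.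
rewrite /poly_subst (fsbig_widen _ [set` T]); first last.
- move=> m [_ /= /negP]; rewrite negbK => /eqP E; by rewrite /preimage /= E scale0r.
- by move=> m /= pm; apply: contraNT pm => /Tsupp ->.
rewrite -fsbig_seq ?undup_uniq //.
under eq_bigr do rewrite pE scaler_suml.
rewrite exchange_big /= big_seq_cond [RHS]big_seq_cond.
apply: eq_bigr => r /andP [rB _]; set m0 := type_of _.
have m0T : m0 \in T by rewrite mem_undup; apply/mapP; exists r.
rewrite (bigD1_seq m0) ?undup_uniq //= eqxx scale1r [X in _ + X]big1 ?addr0.
  exact: monomial_type_ofM.
by move=> m /negPf ->; rewrite scale0r.
Qed.

End ColorTypes.

(** * Color types of a series *)

Section ColorSeries.
Variables (K : fieldType) (C : finType) (P : coloredOperad C).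
Hypothesis Pfin : locally_finite P.
Implicit Types (g h : P -> K) (x y z : P) (a : C) (al : {ffun C -> nat}).

(** The elements with output color [a] and input type [al]. *)
Definition colored a al : set P := [set x | out x = a /\ type_of (inp x) = al].

Lemma xymon_inj a b al be : xymon a al = xymon b be -> a = b /\ al = be.
Proof.
move=> /ffunP E; split; last by apply/ffunP => c; have := E (inr c); rewrite !ffunE.
by have := E (inl a); rewrite !ffunE eqxx; case: eqP.
Qed.

Lemma colt_xymon h a al : colt h (xymon a al) = \sum_(x \in colored a al) h x.
Proof.
apply: eq_fsbigl; apply/seteqP; split=> x /=; first by move/xymon_inj.
by case=> -> ->.
Qed.

(** The power series in the variables [y_c] that is the coefficient of [x_a] in
[colt h]. *)
Definition color_part h a : mps C K := fun al => colt h (xymon a al).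

Lemma color_partE h a al : color_part h a al = \sum_(x \in colored a al) h x.
Proof. exact: colt_xymon. Qed.

Lemma finite_colored a al : finite_set (colored a al).
Proof.
apply: sub_finite_set (Pfin (mdeg al)) => x [_ <-].
by rewrite /= mdeg_type_of.
Qed.

(** The sequences with output colors [cs] whose input colors, all taken
together, have type [al]. *)
Definition colored_seq (cs : seq C) al : set (seq P) :=
  [set zs | map (@out C P) zs = cs /\ type_of (flatten (map (@inp C P) zs)) = al].

Lemma finite_colored_seq cs al : finite_set (colored_seq cs al).
Proof.
apply: sub_finite_set (finite_seqs_le (mdeg al) (finite_arity_le Pfin (mdeg al))).
move=> zs [_ <-] /=; rewrite mdeg_type_of size_flatten /shape -map_comp sumnE.
rewrite big_map; split; first exact: size_le_sum_arity.
by move=> z zzs; exact: (mem_le_sum (fun z => arity z) zzs).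
Qed.

Lemma prod_color_part h cs al :
  (\prod_(c <- cs) color_part h c) al =
  \sum_(zs \in colored_seq cs al) \prod_(z <- zs) h z.
Proof.
elim: cs al => [|c cs IH] al.
  rewrite big_nil; have [->|Nal] := eqVneq al 0.
    rewrite (_ : colored_seq _ _ = [set [::]]) ?fsbig_set1 ?big_nil //.
      by rewrite mps1E eqxx.
    apply/seteqP; split=> [[|z zs] []|_ ->] //=; rewrite type_of_nil.
  rewrite mps1E (negPf Nal); apply/esym/fsbig1.
  move=> [|z zs] [] //= _; rewrite type_of_nil => E.
  by rewrite -E eqxx in Nal.
rewrite big_cons mpsM.
under eq_fsbigr do rewrite IH color_partE mulr_fsuml.
under eq_fsbigr do under eq_fsbigr do rewrite mulr_fsumr.
have finC := finite_colored; have finCs := finite_colored_seq.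
under eq_fsbigr do rewrite pair_fsbig //.
have fin2 (p : {ffun C -> nat} * {ffun C -> nat}) :
    finite_set (colored c p.1 `*` colored_seq cs p.2).
  by apply: finite_setX; [exact: finite_colored | exact: finite_colored_seq].
rewrite fsum_sigma //; last exact: finite_mdecomp.
rewrite [RHS](@reindex_fsbig _ _ _ _ _
  (fun v : ({ffun C -> nat} * {ffun C -> nat}) * (P * seq P) => v.2.1 :: v.2.2)
  ([set p | p.1 + p.2 = al] `*`` (fun p => colored c p.1 `*` colored_seq cs p.2))).
  by apply: eq_fsbigr => v _; rewrite big_cons.
split.
- move=> [[p q] [z zs]] [/= Ea [[/= Eo Ei] [/= Eos Eis]]].
  by split=> /=; rewrite ?Eo ?Eos // type_of_cat Ei Eis.
- move=> [[p q] [z zs]] [[p' q'] [z' zs']]; rewrite !inE /=.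
  move=> [/= Ea [[/= Eo Ei] [/= Eos Eis]]] [/= Ea' [[/= Eo' Ei'] [/= Eos' Eis']]].
  by move=> [Ez Ezs]; rewrite -Ei -Eis -Ei' -Eis' Ez Ezs.
case=> [|z zs] [] //= [Eo Eos] E.
exists ((type_of (inp z), type_of (flatten (map (@inp C P) zs))), (z, zs)) => //.
by split=> //=; rewrite -type_of_cat.
Qed.

Lemma color_part_userie a : color_part (userie K (P := P)) a = variable K a.
Proof.
apply/funext => al; rewrite color_partE.
have E1 : type_of [:: a] = [ffun w => (w == a) : nat].
  by apply/ffunP => c; rewrite !ffunE /= addn0 eq_sym.
have uE x : userie K x = (x == ounit P (out x))%:R.
  congr (nat_of_bool _)%:R; apply/idP/eqP => [|->]; rewrite inE; last by exists (out x).
  by case=> b _ <-; rewrite out_ounit.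
rewrite /variable /monomial -E1; have [->|Nal] := eqVneq al (type_of [:: a]).
  rewrite (fsbigE [:: ounit P a]) //=.
  - rewrite big_cons big_nil mem_set ?addr0 ?uE ?out_ounit ?eqxx //.
    by split; rewrite ?out_ounit ?inp_ounit.
  - by move=> x /= /[!inE] /eqP ->; split; rewrite ?out_ounit ?inp_ounit.
  - move=> x [Ex _] Nx; rewrite uE Ex; case: eqP => // E.
    by move: Nx; rewrite inE -E eqxx.
apply: fsbig1 => x [Ex Ei]; rewrite uE Ex; case: eqP => // E.
by move: Nal; rewrite -Ei E inp_ounit eqxx.
Qed.

(** The series of color types turns the composition product by the
characteristic series of [S] into the substitution of power series. *)
Lemma color_part_odot_charser (S : {fset P}) h a :
  color_part (odot (charser K [set` S]) h) a =
  \sum_(y <- S | out y == a) \prod_(c <- inp y) color_part h c.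
Proof.
apply/funext => al; rewrite color_partE mps_sumE.
under [RHS]eq_bigr do rewrite prod_color_part.
rewrite -[RHS]big_filter [RHS]fsbig_seq ?filter_uniq ?fset_uniq //.
have finCD := finite_colored a al; have finD := finite_decompositions Pfin.
rewrite [RHS]fsum_sigma; [|exact: finite_seq|by move=> y _; exact: finite_colored_seq].
under eq_fsbigr do rewrite odotE.
rewrite fsum_sigma //.
transitivity (\sum_(u \in (colored a al `*`` @decompositions C P) `&`
     [set u | u.2.1 \in S]) \prod_(z <- u.2.2) h z).
  rewrite [RHS]fsbig_mkcondr; apply: eq_fsbigr => u _.
  rewrite /charser; case: ifPn.
    by rewrite inE => /= uS; rewrite mem_set // mul1r.
  move=> Nu; rewrite (_ : (_ \in _) = false) ?mul0r //; apply/negbTE.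
  by apply: contra Nu; rewrite !inE.
rewrite (@reindex_fsbig _ _ _ _ _ (fun v : P * seq P => (fcomp v.1 v.2, v))
  ([set` [seq y <- S | out y == a]] `*`` (fun y => colored_seq (inp y) al))) //.
split.
- move=> [y zs] [/=]; rewrite mem_filter => /andP [/eqP Eo yS] [Ez Ei].
  split=> //; split=> //; split; first by rewrite out_fcomp.
  by rewrite inp_fcomp.
- by move=> [y zs] [y' zs'] _ _ [_ -> ->].
- move=> [x [y zs]] [[[/= Eo Ei] [/= Ez Ex]] /= yS].
  exists (y, zs); last by rewrite /= Ex.
  split=> /=; first by rewrite mem_filter yS -Eo -Ex out_fcomp // eqxx.
  by split=> //; rewrite -(inp_fcomp Ez) Ex.
Qed.

End ColorSeries.

(** * Uniqueness of the solution of the color system *)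

Section Uniqueness.
Variables (K : fieldType) (C : finType) (P : coloredOperad C).
Variables (S : seq P) (rank : C -> nat) (N : nat).
Hypothesis rank_le : forall a, (rank a <= N)%N.
Hypothesis rank_lt : forall y b, y \in S -> inp y = [:: b] -> (rank b < rank (out y))%N.

(** Induction on the degree of the monomial, then on the rank of the color. *)
Lemma color_system_uniq (v f f' : C -> mps C K) :
  (forall a, f a 0 = 0) -> (forall a, f' a 0 = 0) ->
  (forall a, f a = v a + \sum_(y <- S | out y == a) \prod_(c <- inp y) f c) ->
  (forall a, f' a = v a + \sum_(y <- S | out y == a) \prod_(c <- inp y) f' c) ->
  forall a, f a = f' a.
Proof.
move=> f0 f'0 Ef Ef' a; apply/funext => m.
have [n] := ubnP (mdeg m * N.+1 + rank a)%N.
elim: n a m => // n IH a m; rewrite ltnS => le_n.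
rewrite Ef Ef'; congr (_ + _).
rewrite !mps_sumE big_seq_cond [RHS]big_seq_cond.
apply: eq_bigr => y /andP [yS /eqP Ey].
have := inp_gt0 y; case Ei: (inp y) => [|b [|b' cs]] // _; last first.
  apply: prod_mps_local => // c m' lt_m; apply: IH.
  apply: leq_trans le_n; have := rank_le c; nia.
rewrite !big_seq1; apply: IH; apply: leq_trans le_n.
by rewrite ltn_add2l -Ey; exact: rank_lt.
Qed.

End Uniqueness.

(** * Bud generating systems *)

Section BudSystems.
Variables (K : fieldType) (O : operad) (C : finType) (B : budSystem O C).
Hypothesis Ofin : locally_finite O.
Hypothesis Bfact : finitely_factorizes (arity_part [set` rules B] 1).

Lemma bud_locally_finite : locally_finite (Bud C O).
Proof.
move=> n; pose A := [set: C] `*` [set x : O | arity x = n].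
pose U := [set u : seq C | (size u <= n)%N /\ forall c, c \in u -> [set: C] c].
apply: (@sub_finite_set _ _ (\bigcup_(t in A `*` U) [set X : Bud C O | \val X = t])).
  move=> X /= Xn; exists (\val X) => //; split=> /=.
    by split=> //=; rewrite -Xn -size_bud_in.
  by split=> //; rewrite -Xn.
apply: bigcup_finite => [|t _].
  apply: finite_setX; last by apply: finite_seqs_le; exact: finite_finset.
  by apply: finite_setX; [exact: finite_finset | exact: Ofin].
have [[X EX]|NX] := pselect (exists X : Bud C O, \val X = t).
  by apply: sub_finite_set (finite_set1 X) => Y /= EY; apply/val_inj; rewrite EX.
by apply: (@sub_finite_set _ _ set0) => // Y EY; case: NX; exists Y.
Qed.

Lemma rules_rank : exists2 rank : C -> nat,
  forall a, (rank a <= #|C|)%N &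
  forall (y : Bud C O) b, y \in rules B -> inp y = [:: b] ->
    (rank b < rank (out y))%N.
Proof.
have [rank [rank_le rank_lt]] :=
  unary_rank bud_locally_finite (S := arity_part [set` rules B] 1) Bfact.
exists rank => // y b yB Eb.
by apply: rank_lt => //; split=> //; rewrite /arity Eb.
Qed.

(** The series [s] is the inverse of [u - r]. *)
Lemma synt_series : exists2 s : Bud C O -> K,
  s = userie K (P := Bud C O) \+ odot (rserie K B) s &
  synt K B = odot (odot (iserie K B) s) (tserie K B).
Proof.
have Pfin := bud_locally_finite.
have [rank rank_le rank_lt] := rules_rank.
(* This orders the pairs (arity, rank) lexicographically. *)
pose mu (x : Bud C O) := (arity x * #|C|.+1 + rank (out x))%N.
have mu_lt (x : Bud C O) p z : decompositions x p -> rserie K B p.1 != 0 ->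
    z \in p.2 -> (mu z < mu x)%N.
  case: p => y zs [/= Eo Ex]; rewrite /rserie /charser.
  have [|_] := boolP (y \in [set` rules B]); last by rewrite eqxx.
  rewrite inE /= => yB _ zzs; rewrite /mu -Ex out_fcomp // arity_fcomp //.
  case: zs Eo zzs {Ex} => [|z1 [|z2 zs]] // Eo zzs.
    move: zzs; rewrite inE => /eqP ->; rewrite big_seq1 ltn_add2l.
    exact: rank_lt.
  have rz := rank_le (out z).
  suff : (arity z < \sum_(z <- [:: z1, z2 & zs]) arity z)%N by nia.
  rewrite (big_rem z) //= -addn1 leq_add2l.
  have : (0 < size (rem z [:: z1, z2 & zs]))%N by rewrite size_rem.
  by move=> /leq_trans; apply; exact: size_le_sum_arity.
have ex_inv := useriesub_inverse_exists Pfin mu_lt.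
pose s := Defs.oinv (userie K (P := Bud C O) \- rserie K B).
have [Es _] := xgetPex (fun=> 0) ex_inv.
by exists s => //; exact: odot_right_inverseE.
Qed.

End BudSystems.

Theorem proposition3p3p12 (K : fieldType) (charK0 : [pchar K] =i pred0)
    (O : operad) (C : finType) (B : budSystem O C)
    (Bunamb : unambiguous K B) (Ofin : locally_finite O)
    (Bfact : finitely_factorizes (arity_part [set` rules B] 1))
    (f : C -> mps C K) (fsol : color_system_solution B f)
    (a : C) (aI : a \in initial B)
    (al : {ffun C -> nat}) (altype : is_type al)
    (alT : nonempty_word_on (terminal B) (type_word al)) :
  colt (synt K B) (xymon a al) = f a al.
Proof.
have Pfin := bud_locally_finite C Ofin.
have [rank rank_le rank_lt] := rules_rank Ofin Bfact.
have [s Es ->] := synt_series K Ofin Bfact.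
have [f0 Ef] := fsol.
have alT' c : (0 < al c)%N -> c \in terminal B.
  move=> ac; apply: (proj2 alT); apply/flattenP.
  exists (nseq (al c) c); first by apply/mapP; exists c; rewrite ?mem_enum.
  by rewrite mem_nseq ac eqxx.
transitivity (color_part s a al).
  rewrite color_partE colt_xymon; apply: eq_fsbigr => x; rewrite inE => -[Ex Ei].
  rewrite odot_unitsr odot_unitsl Ex mem_set // mul1r big_seq big1 ?mulr1 //.
  move=> c cx; rewrite mem_set //=; apply: alT'.
  by rewrite -Ei ffunE -has_count has_pred1.
have Fs c : color_part s c = variable K c +
    \sum_(y <- rules B | out y == c) \prod_(d <- inp y) color_part s d.
  rewrite -color_part_odot_charser // -(color_part_userie K (Bud C O)).
  apply/funext => be; rewrite {1}Es /= color_partE.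
  rewrite fsbig_split; last exact: finite_colored.
  by rewrite -!color_partE.
suff -> : color_part s a = f a by [].
apply: (color_system_uniq rank_le rank_lt (v := variable K)) => //.
- move=> c; rewrite color_partE; apply: fsbig1 => x [_ /(congr1 (@mdeg _))].
  rewrite mdeg_type_of /mdeg big1 => [E|v _]; last by rewrite ffunE.
  by have := inp_gt0 x; rewrite E.
- by move=> c; rewrite -poly_subst_gpoly; exact: Ef.
Qed.
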